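(* Let $G=Q:L$ be a biextraspecial group with dent space $\mathcal D$. Suppose that $\mathcal D=\mathcal U_1\perp\cdots\perp\mathcal U_k$, where each $\mathcal U_i$ is a nonzero nondegenerate subspace of dimension $n_i$. Let $Q_i$ be the subgroup of $Q$ generated by the dents in $\mathcal U_i$ and let $G_i=Q_i:L$ be the group associated to $\mathcal U_i$, for $i=1,\dots,k$. Then each $G_i$ is a biextraspecial group of rank $n_i$ with dent space $\mathcal U_i$.
   Context: Biextraspecial groups. $L_2(2)=SL_2(2)\cong S_3$; its natural module is $GF(2)^2$. For $m\ge 1$, a finite group $G$ is a biextraspecial group of rank $m$ if: (B1) $G$ has a normal $2$-subgroup $Q$ of order $2^{2+2m}$ with $G/Q\cong L_2(2)$; (B2) $Z=Z(Q)$, with the conjugation action of $G/Q$, is the natural module; (B3) $Q/Z$ is elementary abelian of order $2^{2m}$ and all its composition factors as a module for $G/Q$ over $GF(2)$ are natural modules. Such $G$ splits over $Q$; $L\cong L_2(2)$ is a fixed complement, $G=Q:L$. Dents. A dent is a normal subgroup $D$ of $G$ such that $Z<D\le Q$ and $D/Z$ is an irreducible $L$-submodule of $Q/Z$. Every dent is isomorphic to $2^4$ (singular) or $4^2=C_4\times C_4$ (non-singular). For distinct dents $D_1,D_2$, the diagonal dent $D_1+D_2$ is the full preimage in $Q$ of $\{u\cdot u\varphi:u\in D_1/Z\}$, with $\varphi:D_1/Z\to D_2/Z$ the unique $L$-isomorphism. The dent space $\mathcal D$ is the set of all dents together with a formal zero $0_{\mathcal D}$, with $D+D=0_{\mathcal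 D}$; this is a $GF(2)$-vector space. It carries the nondegenerate alternating form $\beta$, where $\beta(D_1,D_2)$ is $0$ if $[D_1,D_2]=1$ and $1$ otherwise, and the associated quadratic form $q$ with $q(D)=0$ if $D$ is singular and $1$ if $D$ is non-singular. Nondegeneracy and orthogonality are with respect to $\beta$. Since $L$ normalises each dent, it normalises $Q_i$, so the semidirect product $Q_i:L\le G$ makes sense. ''With dent space $\mathcal U_i$'' means that the dents of $G_i$ are exactly the dents of $G$ belonging to $\mathcal U_i$. *)

(* Defs.v *)
From mathcomp Require Import all_boot all_order all_algebra.
From mathcomp Require Import all_fingroup all_solvable.

Set Implicit Arguments.
Unset Strict Implicit.
Unset Printing Implicit Defensive.

Import GroupScope.

Definition SL2_2 : {set {'GL_2(2)}} :=
  [set g : {'GL_2(2)} | (\det (GLval g) == 1)%R].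

(* For a normal series A <= B of G with B / A centralised by Q: the section    *)
(* B / A, with the conjugation action of G / Q, is the natural module          *)
(* GF(2)^2 of SL_2(2).  The isomorphisms G / Q -> SL_2(2) and B / A -> GF(2)^2 *)
(* are given as surjective morphisms on G and B with kernels Q and A.          *)
(* Conjugation and matrices both act on the right.  Every automorphism of      *)
(* SL_2(2) is inner, so the choice of psi does not matter.                     *)
Definition natural_section (gT : finGroupType) (G Q A B : {group gT}) : Prop :=
  exists (psi : {morphism G >-> {'GL_2(2)}})
         (phi : {morphism B >-> 'rV['F_2]_2}),
    [/\ 'ker psi = Q /\ psi @* G = SL2_2,
        'ker phi = A /\ phi @* B = [set: 'rV['F_2]_2]
      & {in B & G, forall x g, phi (x ^ g) = (phi x *m GLval (psi g))%R}].

(* In the last clause, the submodules of Q / Z(Q) are the B / Z(Q) with        *)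
(* Z(Q) <= B <= Q and B normal in G, so that its composition factors are the   *)
(* chief factors of G lying between Z(Q) and Q.                                *)
Definition biextraspecial (gT : finGroupType) (m : nat) (G Q : {group gT}) :
    Prop :=
  [/\ (0 < m)%N,
      [/\ Q <| G, 2.-group Q, #|Q| = (2 ^ (2 + 2 * m))%N
        & G / Q \isog SL2_2],
      natural_section G Q 1%G 'Z(Q)
    & [/\ 2.-abelem (Q / 'Z(Q)), #|Q / 'Z(Q)| = (2 ^ (2 * m))%N
        & forall A B : {group gT}, 'Z(Q) \subset A -> B \subset Q ->
            chief_factor G A B -> natural_section G Q A B]].

Section DentSpace.

Variables (gT : finGroupType) (G Q L : {group gT}).

Definition dent (D : {group gT}) : bool :=
  [&& D <| G, 'Z(Q) \proper D, D \subset Q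
    & acts_irreducibly L (D / 'Z(Q)) 'Q].

(* Vectors of the dent space: Some D stands for the dent D and None for the    *)
(* formal zero.                                                                *)
Notation dvec := (option {group gT}).

Definition dent_space : {set dvec} :=
  [set u : dvec | if u is Some D then dent D else true].

(* phi restricts to an L-isomorphism from D1 / Z(Q) to D2 / Z(Q); its values   *)
(* outside D1 / Z(Q) are irrelevant.                                           *)
Definition L_isom (D1 D2 : {group gT})
    (phi : {ffun coset_of 'Z(Q) -> coset_of 'Z(Q)}) : bool :=
  misom (D1 / 'Z(Q)) (D2 / 'Z(Q)) phi
  && [forall u in D1 / 'Z(Q), forall l in L,
        phi ('Q%act u l) == 'Q%act (phi u) l].

(* For dents of a biextraspecial group the L-isomorphism is unique on D1/Z(Q), *)
(* and diag_set is already a subgroup; << >> only serves to give it the type   *)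
(* {group gT}.                                                                 *)
Definition diag_set (D1 D2 : {group gT}) : {set gT} :=
  [set x in Q | [exists phi, L_isom D1 D2 phi
                 && (coset 'Z(Q) x \in [set u * phi u | u in D1 / 'Z(Q)])]].

Definition dadd (u v : dvec) : dvec :=
  match u, v with
  | None, _ => v
  | _, None => u
  | Some D1, Some D2 =>
      if D1 == D2 then None else Some <<diag_set D1 D2>>%G
  end.

(* Extended to the formal zero by 0. *)
Definition beta (u v : dvec) : 'F_2 :=
  match u, v with
  | Some D1, Some D2 => if [~: D1, D2] == 1 then 0%R else 1%R
  | _, _ => 0%R
  end.

(* Closure under scalars is automatic over GF(2). *)
Definition dent_subspace (U : {set dvec}) : Prop :=
  [/\ U \subset dent_space, None \in U
    & forall u v, u \in U -> v \in U -> dadd u v \in U].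

(* U has a basis of n elements: a linear combination over GF(2) is the sum     *)
(* over the set B of indices with coefficient 1.                               *)
Definition has_dim (U : {set dvec}) (n : nat) : Prop :=
  exists e : 'I_n -> dvec,
    (forall i, e i \in U) /\
    (forall u, u \in U ->
       exists! B : {set 'I_n}, u = \big[dadd/None]_(i in B) e i).

Definition nondegenerate_dents (U : {set dvec}) : Prop :=
  forall u, u \in U -> (forall v, v \in U -> beta u v = 0%R) -> u = None.

(* The dent space is the orthogonal direct sum of the U i. *)
Definition orthogonal_sum (k : nat) (U : 'I_k -> {set dvec}) : Prop :=
  (forall d, d \in dent_space ->
     exists! u : {ffun 'I_k -> dvec},
       (forall i, u i \in U i) /\ d = \big[dadd/None]_(i < k) u i) /\
  (forall i j, i != j ->
     forall u v, u \in U i -> v \in U j -> beta u v = 0%R).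

Definition dents_gen (U : {set dvec}) : {group gT} :=
  <<\bigcup_(D : {group gT} | Some D \in U) D>>%G.

End DentSpace.

(* Main.v *)
Require Import Defs.
From mathcomp Require Import all_boot all_order all_algebra.
From mathcomp Require Import all_fingroup all_solvable.

(* Let V = Q / Z(Q) and L = <x, t> with x of order 3 and t an involution.  As  *)
(* all composition factors of V are natural, x fixes no nontrivial element of  *)
(* V, so that v * v^x * v^(x^2) = 1 for all v.  Hence a subgroup W of C_V(t)   *)
(* spans the L-submodule W * W^x, of order |W|^2, and W is recovered from it   *)
(* as the set of its t-fixed elements.  Thus sending a t-fixed w to the        *)
(* preimage of <w, w^x> identifies C_V(t) with the dent space, additively, and *)
(* a subspace U with a subgroup W such that the dents of U generate the        *)
(* preimage of W * W^x: this gives its order, and its dents are those of U.    *)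
(* The centre of that subgroup is Z(Q), since otherwise it would contain a     *)
(* dent of U orthogonal to all of U.                                           *)

Set Implicit Arguments.
Unset Strict Implicit.
Unset Printing Implicit Defensive.

Import GroupScope.

(** The dictionary [dvec] between [C_V(t)] and the dent space is bijective and additive ([dvecP],
    [dvec_inj], [dadd_dvec]). It turns the subgroup generated by the dents of a subspace into an
    explicit preimage, which gives its order ([card_dents_gen]) and its dents ([mem_subspace_dent]).
    The centre ([center_dents_gen]) comes from the fact that every normal subgroup of [G] strictly
    above [Z(Q)] and inside [Q] contains a dent ([normal_sub_xspan_pre]). The rest is inherited from
    [G]. Since [Q / Z(Q)] is abelian, a subgroup between [Z(Q)] and [Q] is normal in [G] as soon as
    [L] normalises it ([normal_between]). So [G] and [Gi] have the same normal subgroups between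
    [Z(Q)] and [Qi], hence the same chief factors and dents there. Natural sections restrict from
    [G] to [Gi] because [Q * Gi = G] ([natural_section_sub]). *)

(** * An order 3 element without fixed points on an elementary abelian 2-group *)

Section FixedPoints.

Variables (rT : finGroupType) (V : {group rT}) (x t : rT).
Hypotheses (abelV : 2.-abelem V) (nVx : x \in 'N(V)).
Hypotheses (x3 : x ^+ 3 = 1) (t2 : t ^+ 2 = 1) (xt : x ^ t = x^-1).
Hypothesis fpf : forall v, v \in V -> v ^ x = v -> v = 1.

Let cVV : {in V &, commutative mulg}.
Proof. by move=> u v Vu Vv; apply: (centsP (abelem_abelian abelV)). Qed.

Let VJx u : u \in V -> u ^ x \in V.
Proof. by move=> Vu; rewrite memJ_norm. Qed.

Lemma abelem2_sq u : u \in V -> u * u = 1.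
Proof. by case/(abelemP (isT : prime 2)): abelV => _ e2 Vu; rewrite -[RHS](e2 u). Qed.

Lemma abelem2_inv u : u \in V -> u^-1 = u.
Proof. by move=> Vu; apply/eqP; rewrite eq_invg_mul abelem2_sq. Qed.

Lemma fixed_conjE w : (w \in 'C_V[t]) = (w \in V) && (w ^ t == w).
Proof.
by rewrite inE; congr (_ && _); rewrite cent1E -(inj_eq (mulgI t) (w ^ t)) -conjgC.
Qed.

(** The product of the three conjugates of [u] under [x] is fixed by [x], hence trivial, and every
    element of [V] is its own inverse. *)
Lemma conj_order3_fpf u : u \in V -> (u ^ x) ^ x = u * u ^ x.
Proof.
move=> Vu; have Vx := VJx Vu; have Vxx := VJx Vx.
have Vp : u * u ^ x \in V by rewrite groupM.
have e3 : ((u ^ x) ^ x) ^ x = u by rewrite -!conjgM -[x * _]/(x ^+ 3) x3 conjg1.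
apply/eqP; rewrite -[u * _]abelem2_inv // eq_sym eq_invg_mul; apply/eqP/fpf.
  by rewrite groupM.
rewrite conjMg e3 [(u * _) ^ x]conjMg (@cVV (_ * _) u) //; first exact: mulgA.
by rewrite groupM.
Qed.

(** As [t] inverts [x], one has [x * t = t * x^2], so [t] takes [w^x] to [w^(x^2)]. *)
Lemma fixed_conjx_conjt w : w \in V -> w ^ t = w -> (w ^ x) ^ t = w * w ^ x.
Proof.
move=> Vw wt; rewrite -conj_order3_fpf // -!conjgM.
have -> : x * t = t * (x * x).
  by rewrite conjgC xt; congr (_ * _); apply/eqP; rewrite eq_invg_mul -x3.
by rewrite (conjgM w t) wt.
Qed.

(** If [t] moves [h], then [h * h^t] is fixed, and it is nontrivial because [h] is its own
    inverse. *)
Lemma exists_fixed (H : {group rT}) :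
  H \subset V -> t \in 'N(H) -> H :!=: 1 ->
  exists w, [/\ w \in H, w != 1 & w \in 'C_V[t]].
Proof.
move=> sHV nHt /trivgPn[h Hh nh1]; have Vh := subsetP sHV h Hh.
have Hht : h ^ t \in H by rewrite memJ_norm.
have Vht := subsetP sHV _ Hht.
case: (eqVneq (h ^ t) h) => [ht | ht].
  by exists h; rewrite fixed_conjE Vh ht eqxx.
exists (h * h ^ t); split; first exact: groupM.
  by rewrite -(eq_invg_mul h) (abelem2_inv Vh) eq_sym.
rewrite fixed_conjE groupM //= conjMg -(conjgM h) -[t * t]/(t ^+ 2) t2 conjg1.
exact/eqP/cVV.
Qed.

(** For [W] fixed by [t] this is the whole submodule generated by [W]: two conjugates suffice, as
    [w^(x^2) = w * w^x]. *)
Definition xspan (W : {group rT}) : {group rT} := (W <*> W :^ x)%G.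

Lemma sub_xspan (W : {group rT}) : W \subset xspan W.
Proof. exact: joing_subl. Qed.

Lemma xspan_sub (W H : {group rT}) : W \subset H -> x \in 'N(H) -> xspan W \subset H.
Proof. by move=> sWH nHx; rewrite join_subG sWH /= -(normP nHx) conjSg. Qed.

Section Xspan.

Variable W : {group rT}.
Hypothesis sWF : W \subset 'C_V[t].

Let sWV : W \subset V. Proof. by apply: subset_trans sWF (subsetIl _ _). Qed.

Let Wt w : w \in W -> w ^ t = w.
Proof. by move/(subsetP sWF); rewrite fixed_conjE => /andP[_ /eqP]. Qed.

Let sWxV : W :^ x \subset V.
Proof. by rewrite -(normP nVx) conjSg. Qed.

Lemma xspanE : xspan W = W * W :^ x :> {set rT}.
Proof.
apply: cent_joinEr; apply: subset_trans sWxV (subset_trans _ (centS sWV)).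
exact: abelem_abelian abelV.
Qed.

Lemma mem_xspanP u : reflect (exists a b, [/\ a \in W, b \in W & u = a * b ^ x])
  (u \in xspan W).
Proof.
rewrite xspanE; apply: (iffP mulsgP) => [[a c Wa /imsetP[b Wb ->] ->]|[a [b [Wa Wb ->]]]].
  by exists a, b.
by exists a (b ^ x); rewrite ?memJ_conjg.
Qed.

(** Since [t] sends [a * b^x] to [a * b * b^x], a fixed element has [b = 1]. The same computation
    makes [W] and [W^x] meet trivially in [card_xspan]. *)
Lemma xspan_fixed u : u \in xspan W -> u ^ t = u -> u \in W.
Proof.
case/mem_xspanP=> a [b [Wa Wb ->]]; rewrite conjMg (Wt Wa).
have Vb := subsetP sWV b Wb.
rewrite fixed_conjx_conjt ?Wt // => /mulgI /(canRL (mulgK _)).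
by rewrite mulgV => ->; rewrite conj1g mulg1.
Qed.

Lemma card_xspan : #|xspan W| = (#|W| ^ 2)%N.
Proof.
rewrite xspanE TI_cardMg ?cardJg ?mulnn //; apply/trivgP/subsetP=> u /setIP[Wu].
case/imsetP=> b Wb def_u; have Vb := subsetP sWV b Wb.
have : u ^ t = u by apply: Wt.
rewrite def_u fixed_conjx_conjt ?Wt // => /(canRL (mulgK _)).
by rewrite mulgV => ->; rewrite conj1g !inE.
Qed.

Lemma xspan_normx : x \in 'N(xspan W).
Proof.
rewrite inE; apply/subsetP=> _ /imsetP[u /mem_xspanP[a [b [Wa Wb ->]]] ->].
have [Va Vb] := (subsetP sWV a Wa, subsetP sWV b Wb).
apply/mem_xspanP; exists b, (a * b); split; rewrite ?groupM //.
rewrite (conjMg a b) (conjMg a) conj_order3_fpf // (mulgA (a ^ x)) (mulgA b).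
by congr (_ * _); apply: cVV; rewrite ?VJx.
Qed.

Lemma xspan_normt : t \in 'N(xspan W).
Proof.
rewrite inE; apply/subsetP=> _ /imsetP[u /mem_xspanP[a [b [Wa Wb ->]]] ->].
apply/mem_xspanP; exists (a * b), b; split; rewrite ?groupM // conjMg Wt //.
by rewrite fixed_conjx_conjt ?Wt ?(subsetP sWV) // mulgA.
Qed.

End Xspan.

(** The intersection is [t]-invariant, so if nontrivial it has a nontrivial fixed element, which
    then lies in both [A] and [B]. *)
Lemma xspan_TI (A B : {group rT}) :
  A \subset 'C_V[t] -> B \subset 'C_V[t] -> A :&: B = 1 ->
  xspan A :&: xspan B = 1.
Proof.
move=> sAF sBF tiAB; apply/eqP/idPn=> ntI.
have sAV : xspan A \subset V by rewrite xspan_sub ?(subset_trans sAF) ?subsetIl.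
have nIt : t \in 'N(xspan A :&: xspan B).
  by apply: subsetP (normsI _ _) t (set11 t); rewrite sub1set xspan_normt.
have sIV := subset_trans (subsetIl _ (xspan B)) sAV.
have [w [/setIP[Aw Bw] nw1]] := exists_fixed sIV nIt ntI.
rewrite fixed_conjE => /andP[_ /eqP wt].
have : w \in A :&: B by rewrite inE (xspan_fixed sAF) ?(xspan_fixed sBF).
by rewrite tiAB inE (negPf nw1).
Qed.

End FixedPoints.

(** * Projection along a common complement *)

(** The projection of [K * B] onto [B] has kernel [K], so it is injective on [A], and onto by
    cardinality. With [K] the diagonal of two dents [A] and [B] it yields the isomorphism between
    them. *)
Lemma remgr_isom (rT : finGroupType) (V A B K : {group rT}) :
    abelian V -> A \subset V -> B \subset V -> K \subset V ->
    A :&: K = 1 -> K :&: B = 1 -> A \subset K * B -> #|A| = #|B| ->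
  misom A B (remgr K B).
Proof.
move=> cVV sAV sBV sKV tiAK tiKB sAKB oAB.
have nKV : V \subset 'N(K) by apply: sub_abelian_norm.
have defKB : K <*> B = K * B by rewrite norm_joinEr // (subset_trans sBV).
have comp : B \in [complements to K in K <*> B] by apply/complP; rewrite defKB.
have nKKB : K <| K <*> B by rewrite normalYl (subset_trans sBV).
have sAKB' : A \subset K <*> B by rewrite defKB.
have phiM := remgrM comp nKKB.
apply/andP; split.
  apply/forall_inP=> [[u v] /andP[/= Au Av]]; apply/eqP/phiM.
    exact: (subsetP sAKB').
  exact: (subsetP sAKB').
have inj : {in A &, injective (remgr K B)}.
  move=> u v Au Av /= eq_uv; apply/eqP; rewrite eq_mulgV1 -in_set1 -[[set 1]]tiAK.
  rewrite inE groupM ?groupV //= (divgr_eq K B u) eq_uv {2}(divgr_eq K B v).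
  by rewrite invMg mulgA mulgK groupM ?groupV // mem_divgr // (subsetP sAKB).
(* [isom] compares the sets of nonidentity elements, hence the removal of 1 on both sides. *)
rewrite /isom eqEcard card_in_imset; last first.
  by move=> u v /setD1P[_ Au] /setD1P[_ Av]; apply: inj.
have /eqP := oAB; rewrite (cardsD1 1 A) (cardsD1 1 B) !group1 eqSS => /eqP->.
rewrite leqnn andbT; apply/subsetP=> _ /imsetP[u /setD1P[nu1 Au] ->].
rewrite !inE mem_remgr ?(subsetP sAKB) // andbT; apply: contra nu1 => /eqP pu1.
by rewrite -in_set1 -[[set 1]]tiAK inE Au (divgr_eq K B u) pu1 mulg1 mem_divgr ?(subsetP sAKB).
Qed.

(** * Dents as preimages of spans of fixed elements *)

Section Dents.

Variables (gT : finGroupType) (G Q L : {group gT}).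
Local Notation Z := 'Z(Q).
Hypotheses (defG : Q ><| L = G) (cVV : abelian (Q / Z)).

Let nZQ : Q \subset 'N(Z). Proof. exact: gFnorm. Qed.

Lemma center_normal_sd : Z <| G.
Proof. by case/sdprod_context: defG => nQG _ _ _ _; apply: gFnormal_trans. Qed.

(** Such an [H] contains the derived subgroup of [Q], so [Q] normalises it and only [L] matters. *)
Lemma normal_between (H : {group gT}) :
  Z \subset H -> H \subset Q -> (G \subset 'N(H)) = (L \subset 'N(H)).
Proof.
move=> sZH sHQ; case/sdprodP: (defG) => _ <- _ _; rewrite mulG_subG.
by rewrite (sub_der1_norm (subset_trans (der1_min nZQ cVV) sZH) sHQ).
Qed.

(** Irreducibility is rephrased as minimality among normal subgroups strictly above the centre. This
    form mentions no quotient action, so dents of [G] and of [Gi] can be compared directly. *)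
Lemma dentP (D : {group gT}) :
  reflect [/\ Z \proper D, D \subset Q, G \subset 'N(D)
    & forall H : {group gT}, Z \proper H -> H \subset D -> G \subset 'N(H) -> H = D]
  (dent G Q L D).
Proof.
have nZG := normal_norm center_normal_sd.
case/sdprod_context: (defG) => nQG sLG _ nQL _.
have nZL := subset_trans sLG nZG.
have actsE (H : {group gT}) : Z \subset H -> H \subset Q ->
    [acts L, on H / Z | 'Q] = (G \subset 'N(H)).
  move=> sZH sHQ; have nZH : Z <| H by rewrite /normal sZH (subset_trans sHQ).
  by rewrite astabsQ // subsetI nZL normal_between.
apply: (iffP and4P) => [[/andP[_ nDG] pZD sDQ /mingroupP[_ minD]]|[pZD sDQ nDG minD]].
  split=> // H pZH sHD nHG.
  have [sZD sZH] := (proper_sub pZD, proper_sub pZH).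
  have sHQ := subset_trans sHD sDQ.
  have nZH : H \subset 'N(Z) by apply: subset_trans nZQ.
  apply/group_inj; rewrite -(quotientGK (_ : Z <| H)) ?/normal ?sZH //.
  rewrite (minD (H / Z)%G) ?quotientS //=.
    by rewrite quotientGK // /normal sZD (subset_trans sDQ).
  by rewrite actsE // nHG -subG1 quotient_sub1 // (proper_subn pZH).
have [sZD nZD] := (proper_sub pZD, subset_trans sDQ nZQ).
have ZnD : Z <| D by apply/andP.
split=> //.
  by rewrite /normal nDG (subset_trans sDQ) ?normal_sub.
apply/mingroupP; split=> [|Hb /andP[ntHb actHb] sHbD].
  by rewrite /= actsE // nDG -subG1 quotient_sub1 // (proper_subn pZD).
have [H defHb sZH sHD] := inv_quotientS ZnD sHbD.
rewrite defHb (minD H) //.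
  rewrite properEneq sZH andbT; apply: contraNneq ntHb => defZ.
  by rewrite defHb -(group_inj defZ) trivg_quotient.
by rewrite -actsE // -?defHb // (subset_trans sHD).
Qed.

Variables x t : gT.
Hypotheses (Lxt : <<[set x; t]>> = L) (x3 : x ^+ 3 = 1) (t2 : t ^+ 2 = 1).
Hypotheses (xt : x ^ t = x^-1) (abelV : 2.-abelem (Q / Z)).
Hypothesis fpf : forall v, v \in Q / Z -> v ^ coset Z x = v -> v = 1.

Local Notation xb := (coset Z x).
Local Notation tb := (coset Z t).
Local Notation V := (Q / Z).
Local Notation F := 'C_V[tb].

Let nZG : G \subset 'N(Z). Proof. exact: normal_norm center_normal_sd. Qed.
Let sLG : L \subset G. Proof. by case/sdprod_context: defG. Qed.
Let Lx : x \in L. Proof. by rewrite -Lxt mem_gen // !inE eqxx. Qed.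
Let Lt : t \in L. Proof. by rewrite -Lxt mem_gen // !inE eqxx orbT. Qed.
Let nZL : L \subset 'N(Z). Proof. exact: subset_trans nZG. Qed.
Let nZx : x \in 'N(Z). Proof. exact: (subsetP nZL). Qed.
Let nZt : t \in 'N(Z). Proof. exact: (subsetP nZL). Qed.
Let nQL : L \subset 'N(Q). Proof. by case/sdprodP: defG. Qed.
Let nVx : xb \in 'N(V). Proof. by rewrite (subsetP (quotient_norms Z nQL)) ?mem_quotient. Qed.
Let xb3 : xb ^+ 3 = 1. Proof. by rewrite -morphX //= x3 morph1. Qed.
Let tb2 : tb ^+ 2 = 1. Proof. by rewrite -morphX //= t2 morph1. Qed.
Let xbt : xb ^ tb = xb^-1. Proof. by rewrite -morphJ //= xt morphV. Qed.

Let Xsub (W : {group coset_of Z}) : W \subset F -> xspan xb W \subset V.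
Proof. by move=> sWF; rewrite xspan_sub // (subset_trans sWF) ?subsetIl. Qed.

Lemma norm_gens (H : {group coset_of Z}) :
  (L / Z \subset 'N(H)) = (xb \in 'N(H)) && (tb \in 'N(H)).
Proof.
rewrite -Lxt quotient_gen ?subUset ?sub1set ?nZx // gen_subG /quotient morphimU.
by rewrite !morphim_set1 // subUset !sub1set.
Qed.

Lemma xspan_normL (W : {group coset_of Z}) :
  W \subset F -> L / Z \subset 'N(xspan xb W).
Proof.
move=> sWF; rewrite norm_gens.
by rewrite (xspan_normx abelV nVx xb3 fpf sWF) (xspan_normt abelV nVx xb3 xbt fpf sWF).
Qed.

Definition xspan_pre (W : {group coset_of Z}) : {group gT} :=
  (coset Z @*^-1 xspan xb W)%G.

Lemma xspan_preK (W : {group coset_of Z}) : xspan_pre W / Z = xspan xb W.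
Proof. exact: cosetpreK. Qed.

Lemma center_sub_xspan_pre (W : {group coset_of Z}) : Z \subset xspan_pre W.
Proof. exact: sub_cosetpre. Qed.

Lemma xspan_pre_sub (W : {group coset_of Z}) : W \subset F -> xspan_pre W \subset Q.
Proof.
by move=> sWF; rewrite -(quotientGK (center_normal Q)) morphpreS ?Xsub.
Qed.

Lemma xspan_pre_norm (W : {group coset_of Z}) : W \subset F -> G \subset 'N(xspan_pre W).
Proof.
move=> sWF; rewrite normal_between ?center_sub_xspan_pre ?xspan_pre_sub //.
rewrite (subset_trans _ (morphpre_norms _ (xspan_normL sWF))) //.
by rewrite -sub_quotient_pre.
Qed.

Lemma card_xspan_pre (W : {group coset_of Z}) :
  W \subset F -> #|xspan_pre W| = (#|Z| * #|W| ^ 2)%N.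
Proof.
move=> sWF; rewrite -(card_xspan abelV nVx xb3 xbt fpf sWF) -xspan_preK.
by rewrite card_quotient ?Lagrange ?center_sub_xspan_pre // (subset_trans (xspan_pre_sub sWF)).
Qed.

(** [H / Z] is [t]-invariant and nontrivial, so it has a nontrivial [t]-fixed element [w]; being
    also [x]-invariant, it contains the span of [w]. *)
Lemma normal_sub_xspan_pre (H : {group gT}) :
  Z \proper H -> H \subset Q -> G \subset 'N(H) ->
  exists w, [/\ w \in F, w \in H / Z, w != 1 & xspan_pre <[w]> \subset H].
Proof.
move=> pZH sHQ nHG; have sZH := proper_sub pZH.
have nHL := quotient_norms Z (subset_trans sLG nHG).
have nZH : Z <| H by rewrite /normal sZH (subset_trans sHQ).
have ntH : (H / Z)%G :!=: 1.
  by rewrite /= -subG1 quotient_sub1 ?(proper_subn pZH) ?normal_norm.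
move: nHL; rewrite norm_gens => /andP[nHx nHt].
have [w [Hw nw1 Fw]] := exists_fixed abelV tb2 (quotientS Z sHQ) nHt ntH.
exists w; split=> //; rewrite -(quotientGK nZH) morphpreS // xspan_sub //.
by rewrite cycle_subG.
Qed.

Lemma mem_xspan_fixed (W : {group coset_of Z}) w :
  W \subset F -> w \in F -> w \in xspan xb W -> w \in W.
Proof.
move=> sWF; rewrite fixed_conjE => /andP[_ /eqP wt] Xw.
exact: (xspan_fixed abelV nVx xb3 xbt fpf sWF).
Qed.

Lemma mem_cycle_fixed w u : w \in F -> u \in <[w]> -> (u == 1) || (u == w).
Proof.
case/setIP=> Vw _; have [->|nw1] := eqVneq w 1; first by rewrite cycle1 => /set1gP->; rewrite eqxx.
by rewrite (cycle2g (abelem_order_p abelV Vw nw1)) !inE.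
Qed.

(** Minimality: a smaller normal subgroup contains the span of some nontrivial fixed [u], and [w] is
    the only nontrivial fixed element of its own span. *)
Lemma dent_xspan_pre w : w \in F -> w != 1 -> dent G Q L (xspan_pre <[w]>).
Proof.
move=> Fw nw1; have sWF : <[w]> \subset F by rewrite cycle_subG.
have Xw : w \in xspan xb <[w]> by rewrite (subsetP (sub_xspan _ _)) ?cycle_id.
have sXQ := xspan_pre_sub sWF; have nXZ := subset_trans sXQ nZQ.
have pZX : Z \proper xspan_pre <[w]>.
  rewrite properE center_sub_xspan_pre -quotient_sub1 // xspan_preK.
  by apply: contra nw1 => /subsetP/(_ w Xw); rewrite inE.
apply/dentP; split=> // [|H pZH sHX nHG]; first exact: xspan_pre_norm.
have [u [Fu Hu nu1 sXuH]] := normal_sub_xspan_pre pZH (subset_trans sHX sXQ) nHG.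
have Xu : u \in xspan xb <[w]>.
  by rewrite -xspan_preK (subsetP (quotientS _ sHX)).
have := mem_cycle_fixed Fw (mem_xspan_fixed sWF Fu Xu); rewrite (negPf nu1) => /eqP def_u.
by apply/eqP; rewrite -val_eqE eqEsubset sHX -def_u.
Qed.

Lemma dent_xspan_preP D :
  dent G Q L D -> exists w, [/\ w \in F, w != 1 & D = xspan_pre <[w]>].
Proof.
case/dentP=> // pZD sDQ nDG minD.
have [w [Fw Dw nw1 sXD]] := normal_sub_xspan_pre pZD sDQ nDG.
exists w; split=> //; apply/esym/minD=> //; last by rewrite xspan_pre_norm ?cycle_subG.
by case/dentP: (dent_xspan_pre Fw nw1).
Qed.

Lemma xspan_pre_cycle_inj w1 w2 :
  w1 \in F -> w2 \in F -> w2 != 1 -> xspan_pre <[w1]> = xspan_pre <[w2]> -> w1 = w2.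
Proof.
move=> Fw1 Fw2 nw2 eqX; have : w2 \in xspan xb <[w1]>.
  by rewrite -xspan_preK eqX xspan_preK (subsetP (sub_xspan _ _)) ?cycle_id.
move/(mem_xspan_fixed _ Fw2); rewrite cycle_subG => /(_ Fw1) /(mem_cycle_fixed Fw1).
by rewrite (negPf nw2) => /eqP.
Qed.

Definition dvec w : option {group gT} :=
  if w == 1 then None else Some (xspan_pre <[w]>).

Lemma dvec_inj : {in F &, injective dvec}.
Proof.
move=> w1 w2 Fw1 Fw2; rewrite /dvec; case: (eqVneq w1 1) => [->|nw1]; case: (eqVneq w2 1) => //.
by move=> nw2 /Some_inj; apply: xspan_pre_cycle_inj.
Qed.

Lemma dvecP u : u \in dent_space G Q L -> exists2 w, w \in F & u = dvec w.
Proof.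
rewrite inE; case: u => [D|_]; last by exists 1; rewrite ?group1 // /dvec eqxx.
case/dent_xspan_preP=> w [Fw nw1 ->]; exists w; rewrite // /dvec (negPf nw1) //.
Qed.

Lemma qact_coset u l : l \in L -> 'Q%act u l = u ^ coset Z l.
Proof. by move=> Ll; rewrite qactJ (subsetP nZL). Qed.

(** * Addition of dents is multiplication of fixed elements *)

Section Diagonal.

Variables w1 w2 : coset_of Z.
Hypotheses (Fw1 : w1 \in F) (Fw2 : w2 \in F).
Hypotheses (nw1 : w1 != 1) (nw2 : w2 != 1) (nw12 : w1 != w2).

Let sF w : w \in F -> <[w]> \subset F.
Proof. by rewrite cycle_subG. Qed.

Let Xw w : w \in xspan xb <[w]>.
Proof. by rewrite (subsetP (sub_xspan _ _)) ?cycle_id. Qed.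

Let Fw12 : w1 * w2 \in F. Proof. exact: groupM. Qed.

Let nw12_1 : w1 * w2 != 1.
Proof.
rewrite -eq_invg_mul (abelem2_inv abelV) //.
by case/setIP: Fw1.
Qed.

(** Commuting with [t], [phi] must send [w1] to [w2], the only nontrivial fixed element of the
    target. So [a * phi a] is 1 or [w1 * w2] for [a] in [<[w1]>], and commuting with [x] extends
    this to the span. *)
Lemma L_isom_diag (phi : {ffun coset_of Z -> coset_of Z}) u :
  L_isom L (xspan_pre <[w1]>) (xspan_pre <[w2]>) phi -> u \in xspan xb <[w1]> ->
  u * phi u \in xspan xb <[w1 * w2]>.
Proof.
case/andP; rewrite !xspan_preK => /misomP[phiM iso] /forall_inP phiL Xu.
have phi_lin v l : v \in xspan xb <[w1]> -> l \in L -> phi (v ^ coset Z l) = phi v ^ coset Z l.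
  by move=> Xv Ll; have /forall_inP/(_ l Ll)/eqP := phiL v Xv; rewrite !qact_coset.
have phi1 : phi 1 = 1 := morph1 (morphm_morphism phiM).
have pM : {in xspan xb <[w1]> &, {morph phi : a b / a * b}} := morphicP phiM.
have phi_w1 : phi w1 = w2.
  have /setD1P[n1 Xp] : phi w1 \in (xspan xb <[w2]>)^#.
    by rewrite -(eqP iso) /= (imset_f phi) // !inE nw1 Xw.
  have Fp : phi w1 \in F.
    rewrite fixed_conjE (subsetP (Xsub (sF Fw2)) _ Xp) -phi_lin ?Xw //=.
    by move: Fw1; rewrite fixed_conjE => /andP[_ /eqP->].
  have := mem_cycle_fixed Fw2 (mem_xspan_fixed (sF Fw2) Fp Xp).
  by rewrite (negPf n1) => /eqP.
have step a : a \in <[w1]> -> a * phi a \in <[w1 * w2]>.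
  case/(mem_cycle_fixed Fw1)/orP=> /eqP->; first by rewrite phi1 mulg1.
  by rewrite phi_w1 cycle_id.
have sW1 := subsetP (sub_xspan xb <[w1]>).
have [a [b [Wa Wb ->]]] := mem_xspanP abelV nVx (sF Fw1) _ Xu.
have Xbx : b ^ xb \in xspan xb <[w1]>.
  by rewrite memJ_norm ?sW1 // (xspan_normx abelV nVx xb3 fpf (sF Fw1)).
rewrite (pM a _ (sW1 a Wa) Xbx) (phi_lin b x (sW1 b Wb) Lx).
have -> : a * b ^ xb * (phi a * phi b ^ xb) = (a * phi a) * (b * phi b) ^ xb.
  rewrite (conjMg b (phi b)) (mulgA (a * _)) -(mulgA a (b ^ xb)).
  rewrite (centsP cVV (b ^ xb) _ (phi a)) ?(subsetP (Xsub (sF Fw1)) _ Xbx) //.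
    by rewrite (mulgA a (phi a)) (mulgA _ (b ^ xb)).
  case/(mem_cycle_fixed Fw1)/orP: Wa => /eqP->; first by rewrite phi1.
  by rewrite phi_w1; case/setIP: Fw2.
apply/(mem_xspanP abelV nVx (sF Fw12)).
by exists (a * phi a), (b * phi b); split; rewrite ?step.
Qed.

Let card_X w : w \in F -> w != 1 -> #|xspan xb <[w]>| = 4.
Proof.
move=> Fw nw; rewrite (card_xspan abelV nVx xb3 xbt fpf (sF Fw)).
by rewrite [#|_|](abelem_order_p abelV _ nw) //; case/setIP: Fw.
Qed.

Let xspan_cycle_TI u v : u \in F -> v \in F -> u != v ->
  xspan xb <[u]> :&: xspan xb <[v]> = 1.
Proof.
move=> Fu Fv nuv; apply: (xspan_TI abelV nVx xb3 tb2 xbt fpf); rewrite ?sF //.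
apply/trivgP/subsetP=> z /setIP[/(mem_cycle_fixed Fu) + /(mem_cycle_fixed Fv)].
by rewrite inE; case: (z == 1) => //= /eqP->; rewrite (negPf nuv).
Qed.

(** Both sides have 4 elements: if [u * phi u = v * phi v], then [v^-1 * u] lies in the spans of
    both [w1] and [w2], which meet trivially. *)
Lemma L_isom_diag_set (phi : {ffun coset_of Z -> coset_of Z}) :
  L_isom L (xspan_pre <[w1]>) (xspan_pre <[w2]>) phi ->
  [set u * phi u | u in xspan xb <[w1]>] = xspan xb <[w1 * w2]>.
Proof.
move=> iso; apply/eqP; rewrite eqEcard; apply/andP; split.
  by apply/subsetP=> _ /imsetP[u Xu ->]; apply: L_isom_diag.
rewrite card_in_imset ?card_X // => u v Xu Xv /= eq_uv.
have phiB z : z \in xspan xb <[w1]> -> phi z \in xspan xb <[w2]>.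
  case/andP: iso; rewrite !xspan_preK => /misomP[phiM /isom_im <-] _ Xz.
  by rewrite (mem_morphim (morphm_morphism phiM)).
apply/eqP; rewrite eq_sym eq_mulVg1 -in_set1 -[[set 1]](xspan_cycle_TI Fw1 Fw2 nw12).
rewrite inE groupM ?groupV //=.
have -> : v^-1 * u = phi v * (phi u)^-1.
  by apply: (canRL (mulgK _)); rewrite -mulgA eq_uv mulKg.
by rewrite groupM ?groupV ?phiB.
Qed.

(* Projection onto the second dent along the diagonal one commutes with L.     *)
Lemma L_isom_exists :
  exists phi : {ffun coset_of Z -> coset_of Z},
    L_isom L (xspan_pre <[w1]>) (xspan_pre <[w2]>) phi.
Proof.
set A := xspan xb <[w1]>; set B := xspan xb <[w2]>; set K := xspan xb <[w1 * w2]>.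
have tiAK : A :&: K = 1.
  apply: xspan_cycle_TI => //.
  by rewrite -{1}[w1]mulg1 (inj_eq (mulgI w1)) eq_sym.
have tiKB : K :&: B = 1.
  apply: xspan_cycle_TI => //.
  by rewrite -{2}[w2]mul1g (inj_eq (mulIg w2)).
have nX w : w \in F -> xb \in 'N(xspan xb <[w]>).
  by move=> Fw; rewrite (xspan_normx abelV nVx xb3 fpf (sF Fw)).
have sAKB : A \subset K * B.
  rewrite -norm_joinEr ?(subset_trans (Xsub (sF Fw2))) ?sub_abelian_norm ?Xsub ?sF //.
  rewrite xspan_sub //; last by rewrite -cycle_subG normsY ?cycle_subG ?nX.
  have -> : w1 = w1 * w2 * w2.
    by rewrite -mulgA (abelem2_sq abelV) ?mulg1 //; case/setIP: Fw2.
  by rewrite cycle_subG groupM ?(subsetP (joing_subl _ _) _ (Xw _)) //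
     ?(subsetP (joing_subr _ _) _ (Xw _)).
have oAB : #|A| = #|B| by rewrite !card_X.
have := remgr_isom cVV (Xsub (sF Fw1)) (Xsub (sF Fw2)) (Xsub (sF Fw12)) tiAK tiKB sAKB oAB.
case/andP=> /forall_inP phiM /eqP phi_im.
exists (finfun (remgr K B)); rewrite /L_isom !xspan_preK; apply/andP; split.
  rewrite /misom /isom (eq_imset _ (ffunE _)) phi_im eqxx andbT.
  by apply/forall_inP=> u Au; rewrite !ffunE phiM.
apply/forall_inP=> u Au; apply/forall_inP=> l Ll; rewrite !qact_coset // !ffunE.
have nXl w : w \in F -> coset Z l \in 'N(xspan xb <[w]>).
  by move=> Fw; rewrite (subsetP (xspan_normL (sF Fw))) // mem_quotient.
have KBu := subsetP sAKB u Au.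
by rewrite {1}(divgr_eq K B u) conjMg remgrMid ?memJ_norm ?nXl ?mem_divgr ?mem_remgr.
Qed.

(** [diag_set] quantifies existentially over [phi]: one inclusion holds because every [phi] gives
    the same diagonal, the other because some [phi] exists. *)
Lemma diag_xspan_pre :
  <<diag_set Q L (xspan_pre <[w1]>) (xspan_pre <[w2]>)>>%G = xspan_pre <[w1 * w2]>.
Proof.
suffices def : diag_set Q L (xspan_pre <[w1]>) (xspan_pre <[w2]>) = xspan_pre <[w1 * w2]>.
  by apply/group_inj; rewrite /= def genGid.
have sXQ := xspan_pre_sub (sF Fw12).
apply/setP=> y; rewrite inE.
apply/andP/idP=> [[Qy /existsP[phi /andP[iso]]]|Xy].
  rewrite xspan_preK L_isom_diag_set // => Xy.
  by apply/morphpreP; rewrite (subsetP nZQ).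
split; first by rewrite (subsetP sXQ).
have [phi iso] := L_isom_exists; apply/existsP; exists phi.
by rewrite iso xspan_preK L_isom_diag_set // -xspan_preK mem_quotient.
Qed.

End Diagonal.

Lemma dadd_dvec w1 w2 :
  w1 \in F -> w2 \in F -> dadd Q L (dvec w1) (dvec w2) = dvec (w1 * w2).
Proof.
move=> Fw1 Fw2; rewrite /dvec.
have [->|nw1] := eqVneq w1 1; first by rewrite mul1g.
have [->|nw2] := eqVneq w2 1; first by rewrite mulg1 (negPf nw1).
rewrite /=; case: eqP => [/(xspan_pre_cycle_inj Fw1 Fw2 nw2)->|neqD].
  by rewrite (abelem2_sq abelV) ?eqxx //; case/setIP: Fw2.
have nw12 : w1 != w2 by apply: contra_notN neqD => /eqP->.
rewrite -eq_invg_mul (abelem2_inv abelV) ?(negPf nw12) ?diag_xspan_pre //.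
by case/setIP: Fw1.
Qed.

(** * The subgroup generated by the dents of a subspace *)

Section Subspace.

Variable U : {set option {group gT}}.
Hypothesis subU : dent_subspace G Q L U.

Definition fixed_of_subspace : {set coset_of Z} := [set w in F | dvec w \in U].

Lemma fixed_of_subspaceE w :
  (w \in fixed_of_subspace) = (w \in F) && (dvec w \in U).
Proof. exact: in_set. Qed.

Lemma fixed_of_subspace_group_set : group_set fixed_of_subspace.
Proof.
case: subU => _ U0 UD; apply/group_setP; split=> [|u v].
  by rewrite fixed_of_subspaceE group1 /dvec eqxx.
rewrite !fixed_of_subspaceE => /andP[Fu Uu] /andP[Fv Uv].
by rewrite groupM //= -dadd_dvec ?UD.
Qed.

Canonical fixed_of_subspace_group := Group fixed_of_subspace_group_set.

Lemma fixed_of_subspace_sub : fixed_of_subspace \subset F.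
Proof. by apply/subsetP=> w; rewrite fixed_of_subspaceE => /andP[]. Qed.

Lemma card_fixed_of_subspace : #|fixed_of_subspace| = #|U|.
Proof.
case: subU => sUD _ _; have <- : dvec @: fixed_of_subspace = U.
  apply/setP=> u; apply/imsetP/idP=> [[w + ->]|Uu]; first by rewrite fixed_of_subspaceE => /andP[].
  have [w Fw def_u] := dvecP (subsetP sUD u Uu).
  by exists w; rewrite // fixed_of_subspaceE Fw -def_u.
rewrite card_in_imset //; apply: sub_in2 dvec_inj => w.
exact: (subsetP fixed_of_subspace_sub).
Qed.

Lemma dents_gen_sub : dents_gen U \subset xspan_pre fixed_of_subspace_group.
Proof.
rewrite gen_subG; apply/bigcupsP=> D UD; case: subU => sUD _ _.
have := subsetP sUD _ UD; rewrite inE => /dent_xspan_preP[w [Fw nw1 defD]].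
rewrite defD morphpreS // xspan_sub //; last first.
  exact: (xspan_normx abelV nVx xb3 fpf fixed_of_subspace_sub).
rewrite cycle_subG (subsetP (sub_xspan _ _)) //.
by rewrite fixed_of_subspaceE Fw /dvec (negPf nw1) -defD.
Qed.

Lemma dent_sub_dents_gen D : Some D \in U -> D \subset dents_gen U.
Proof. by move=> UD; apply: subset_trans (subset_gen _); apply: (bigcup_max D). Qed.

(** No new dents arise: the fixed element defining [D] lies in the span of the fixed elements of
    [U], hence is one of them. *)
Lemma mem_subspace_dent D : dent G Q L D -> D \subset dents_gen U -> Some D \in U.
Proof.
case/dent_xspan_preP=> w [Fw nw1 ->] sDQ.
have /(quotientS Z) := subset_trans sDQ dents_gen_sub.
rewrite !xspan_preK => /subsetP/(_ w).
rewrite (subsetP (sub_xspan _ _)) ?cycle_id // => /(_ isT).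
move/(mem_xspan_fixed fixed_of_subspace_sub Fw).
by rewrite fixed_of_subspaceE /dvec (negPf nw1) => /andP[].
Qed.

Hypothesis ntU : U != [set None].

Lemma subspace_dent : exists D, Some D \in U.
Proof.
case: subU => _ U0 _; case: (pickP (fun D => Some D \in U)) => [D UD|noD]; first by exists D.
by case/negP: ntU; apply/eqP/setP=> [[D|]]; rewrite !inE ?U0 ?noD.
Qed.

Lemma center_sub_dents_gen : Z \subset dents_gen U.
Proof.
have [D UD] := subspace_dent; apply: subset_trans (dent_sub_dents_gen UD).
case: subU => sUD _ _; have := subsetP sUD _ UD; rewrite inE.
by case/dentP=> // /proper_sub.
Qed.

Lemma dents_genE : dents_gen U = xspan_pre fixed_of_subspace_group.
Proof.
apply/eqP; rewrite -val_eqE eqEsubset dents_gen_sub /=.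
have sQF := subset_trans dents_gen_sub (xspan_pre_sub fixed_of_subspace_sub).
have nZQi : Z <| dents_gen U by rewrite /normal center_sub_dents_gen (subset_trans sQF).
rewrite -(quotientGK nZQi) morphpreS //.
have sub w : w \in fixed_of_subspace -> w != 1 -> xspan xb <[w]> \subset dents_gen U / Z.
  rewrite fixed_of_subspaceE => /andP[Fw] + nw1; rewrite /dvec (negPf nw1) => /dent_sub_dents_gen.
  by move/(quotientS Z); rewrite xspan_preK.
have sub1 w : w \in fixed_of_subspace -> w != 1 -> <[w]> :^ xb \subset dents_gen U / Z.
  by move=> Ww nw; apply: subset_trans (sub w Ww nw); apply: joing_subr.
rewrite join_subG; apply/andP; split; apply/subsetP=> w.
  have [->|nw1] := eqVneq w 1; first by rewrite group1.
  by move=> Ww; rewrite (subsetP (sub w Ww nw1)) // (subsetP (sub_xspan _ _)) ?cycle_id.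
case/imsetP=> v Wv ->; have [->|nv1] := eqVneq v 1; first by rewrite conj1g group1.
by rewrite (subsetP (sub1 v Wv nv1)) // memJ_conjg cycle_id.
Qed.

Lemma dents_gen_subQ : dents_gen U \subset Q.
Proof. by rewrite dents_genE xspan_pre_sub ?fixed_of_subspace_sub. Qed.

Lemma dents_gen_norm : G \subset 'N(dents_gen U).
Proof. by rewrite dents_genE xspan_pre_norm ?fixed_of_subspace_sub. Qed.

Lemma card_dents_gen : #|dents_gen U| = (#|Z| * #|U| ^ 2)%N.
Proof.
by rewrite dents_genE card_xspan_pre ?fixed_of_subspace_sub //= card_fixed_of_subspace.
Qed.

(** The centre is characteristic, hence normalised by [G]. Were it larger than [Z], it would contain
    a dent, which belongs to [U] and commutes with every dent of [U]. *)
Lemma center_dents_gen : nondegenerate_dents U -> 'Z(dents_gen U) = Z.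
Proof.
move=> ndU; apply/eqP; rewrite eqEsubset andbC subsetI center_sub_dents_gen.
have cZ : Z \subset 'C(dents_gen U) := subset_trans (subsetIr Q _) (centS dents_gen_subQ).
rewrite cZ /=; apply/idPn=> nsZ.
have pZ : Z \proper 'Z(dents_gen U) by rewrite properE nsZ subsetI center_sub_dents_gen cZ.
have sZQ : 'Z(dents_gen U) \subset Q := subset_trans (center_sub _) dents_gen_subQ.
have nZ : G \subset 'N('Z(dents_gen U)) := char_norm_trans (center_char _) dents_gen_norm.
have [w [Fw _ nw1 sXZ]] := normal_sub_xspan_pre pZ sZQ nZ.
have UD : Some (xspan_pre <[w]>) \in U.
  apply: mem_subspace_dent; first exact: dent_xspan_pre.
  exact: subset_trans sXZ (center_sub _).
suffices ort v : v \in U -> beta (Some (xspan_pre <[w]>)) v = 0%R by have := ndU _ UD ort.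
case: v => [D|] //= UD'; case: eqP => // /commG1P/negP[].
apply: subset_trans sXZ _; apply: subset_trans (subsetIr _ _) _.
by rewrite centS ?dent_sub_dents_gen.
Qed.

End Subspace.

End Dents.

(** * Dimension count, and generators of [SL_2(2)] *)

Lemma card_has_dim (gT : finGroupType) (G Q L : {group gT}) U n :
  dent_subspace G Q L U -> has_dim Q L U n -> #|U| = (2 ^ n)%N.
Proof.
case=> _ U0 UD [e [Ue uniq_e]]; pose S (B : {set 'I_n}) := \big[dadd Q L/None]_(i in B) e i.
have US B : S B \in U by apply: (big_ind (fun u => u \in U)).
have <- : S @: setT = U.
  apply/setP=> u; apply/imsetP/idP=> [[B _ ->] //|Uu].
  by have [B [-> _]] := uniq_e u Uu; exists B.
rewrite card_imset -?powersetT ?card_powerset ?cardsT ?card_ord //.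
by move=> B C eqS; have [D [_ uD]] := uniq_e _ (US B); rewrite -(uD B) ?(uD C).
Qed.

(** The only unit of [F_2] is 1. *)
Lemma SL2_2E : SL2_2 = [set: {'GL_2(2)}].
Proof.
apply/setP=> g; rewrite !inE; have := valP g.
rewrite unitmxE GRing.unitfE; move: (\det _)%R => d.
by case: d => [[|[|d]]].
Qed.

Lemma card_SL2_2 : #|SL2_2| = 6.
Proof. by rewrite SL2_2E (card_GL_2 'F_2) card_Fp. Qed.

Lemma GL2_2_gens : exists X T : {'GL_2(2)}, [/\ #[X] = 3, #[T] = 2 & X ^ T = X^-1].
Proof.
(* [mX] has characteristic polynomial [X^2 + X + 1], hence order 3; [mT] swaps the coordinates. *)
pose mX : 'M['F_2]_2 := (\matrix_(i, j) (~~ ((i == 0) && (j == 0)))%:R)%R.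
pose mT : 'M['F_2]_2 := (\matrix_(i, j) (i != j)%:R)%R.
have eqX : (mX *m (mX *m mX) = 1%:M)%R.
  apply/matrixP=> i j; do !rewrite !(mxE, big_ord_recl, big_ord0).
  by case: i => [[|[|i]]] //; case: j => [[|[|j]]] // *; apply/val_inj; vm_compute.
have eqT : (mT *m mT = 1%:M)%R.
  apply/matrixP=> i j; do !rewrite !(mxE, big_ord_recl, big_ord0).
  by case: i => [[|[|i]]] //; case: j => [[|[|j]]] // *; apply/val_inj; vm_compute.
have eqXT : (mX *m (mT *m mX) = mT)%R.
  apply/matrixP=> i j; do !rewrite !(mxE, big_ord_recl, big_ord0).
  by case: i => [[|[|i]]] //; case: j => [[|[|j]]] // *; apply/val_inj; vm_compute.
have nX1 : mX != 1%:M%R.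
  by apply/eqP=> /matrixP/(_ 0%R 0%R)/eqP; rewrite !mxE.
have nT1 : mT != 1%:M%R.
  by apply/eqP=> /matrixP/(_ 0%R 0%R)/eqP; rewrite !mxE.
have [uX _] := mulmx1_unit eqX; have [uT _] := mulmx1_unit eqT.
exists (FinRing.unit 'M['F_2]_2 uX), (FinRing.unit 'M['F_2]_2 uT); split=> //.
- by apply: nt_prime_order => //; apply: val_inj.
- by apply: nt_prime_order => //; apply: val_inj.
rewrite conjgE; apply/(canLR (mulKg _))/(canRL (mulgK _)); apply: val_inj.
by rewrite /= -GRing.mulrA.
Qed.

(** * Natural sections and the action of the complement *)

Lemma morphim_ker_complement (gT rT : finGroupType) (G K : {group gT})
    (f : {morphism G >-> rT}) :
  'ker f * K = G -> f @* K = f @* G.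
Proof.
move=> defG; have <- : f @* ('ker f * K) = f @* K.
  by rewrite morphimMl ?subsetIl // morphim_ker mul1g.
by rewrite defG.
Qed.

Lemma natural_section_sub (gT : finGroupType) (G Q A B K : {group gT}) :
  natural_section G Q A B -> Q * K = G -> natural_section K (K :&: Q)%G A B.
Proof.
case=> psi [phi [[kerp imp] kphi phiJ]] defG.
have sKG : K \subset G by rewrite -defG mulG_subr.
exists (restrm_morphism sKG psi), phi; split=> //; last first.
  by move=> b g Bb Kg; rewrite phiJ ?(subsetP sKG).
split; first by rewrite ker_restrm kerp.
by rewrite im_restrm (morphim_ker_complement (f := psi)) ?kerp.
Qed.

Section Complement.

Variables (gT : finGroupType) (G Q L A B : {group gT}).
Hypotheses (defG : Q ><| L = G) (natAB : natural_section G Q A B).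

(** [psi] is injective on [L] and maps it onto [SL2_2], so the matrix generators lift with their
    relations. They generate [L], which has order 6, since 3 and 2 divide the order of their
    span. *)
Lemma natural_section_gens : exists x t,
  [/\ <<[set x; t]>> = L, x != 1, x ^+ 3 = 1, t ^+ 2 = 1 & x ^ t = x^-1].
Proof.
have [psi [phi [[kerp imp] _ _]]] := natAB.
case/sdprodP: (defG) => _ defQL _ tiQL.
have sQG : Q \subset G by rewrite -defQL mulG_subl.
have sLG : L \subset G by rewrite -defQL mulG_subr.
have imL : psi @* L = SL2_2.
  by rewrite (morphim_ker_complement (f := psi)) ?kerp.
have injL g : g \in L -> psi g = 1 -> g = 1.
  move=> Lg pg; apply/set1gP; rewrite -tiQL inE Lg andbT -kerp.
  by rewrite !inE (subsetP sLG) //= pg.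
have inL X : exists2 g, g \in L & psi g = X.
  have : X \in psi @* L by rewrite imL SL2_2E inE.
  by case/morphimP=> g _ Lg ->; exists g.
have [X [T [oX oT XT]]] := GL2_2_gens.
have [[x Lx pX] [t Lt pT]] := (inL X, inL T).
have [Gx Gt] := (subsetP sLG x Lx, subsetP sLG t Lt).
have x3 : x ^+ 3 = 1.
  by apply: injL; rewrite ?groupX // morphX // pX; have := expg_order X; rewrite oX.
have t2 : t ^+ 2 = 1.
  by apply: injL; rewrite ?groupX // morphX // pT; have := expg_order T; rewrite oT.
have nx1 : x != 1.
  by apply/eqP=> x1; move: oX; rewrite -pX x1 morph1 order1.
have nt1 : t != 1.
  by apply/eqP=> t1; move: oT; rewrite -pT t1 morph1 order1.
exists x, t; split=> //; last first.
  apply: (mulgI x); rewrite mulgV; apply: injL; first by rewrite !groupM ?groupV ?groupJ.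
  by rewrite morphM ?groupJ // morphJ // pX pT XT mulgV.
have ox := nt_prime_order (isT : prime 3) x3 nx1.
have ot := nt_prime_order (isT : prime 2) t2 nt1.
apply/eqP; rewrite eqEcard gen_subG subUset !sub1set Lx Lt /=.
have -> : #|L| = 6.
  by rewrite -card_SL2_2 -imL card_morphim (setIidPr sLG) kerp -indexgI setIC tiQL indexg1.
apply: dvdn_leq => //; rewrite (@Gauss_dvd 3 2) // -{1}ox -ot.
by rewrite !order_dvdG // mem_gen // !inE eqxx ?orbT.
Qed.

End Complement.

(** [C_V(x)] is an [L]-submodule because [t] inverts [x]. If it were nontrivial, it would contain a
    composition factor, where [x] acts trivially; but [L] acts faithfully on the natural module. *)
Lemma biextraspecial_fpf (gT : finGroupType) m (G Q L : {group gT}) x t :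
    biextraspecial m G Q -> Q ><| L = G -> <<[set x; t]>> = L -> x != 1 -> x ^ t = x^-1 ->
  forall v, v \in Q / 'Z(Q) -> v ^ coset 'Z(Q) x = v -> v = 1.
Proof.
case=> _ _ _ [abelV _ natF] defG Lxt nx1 xt v Vv vx.
have cVV := abelem_abelian abelV.
have nZG := normal_norm (center_normal_sd defG).
case/sdprodP: (defG) => _ defQL nQL tiQL.
have sQG : Q \subset G by rewrite -defQL mulG_subl.
have sLG : L \subset G by rewrite -defQL mulG_subr.
have nZL := subset_trans sLG nZG.
have Lx : x \in L by rewrite -Lxt mem_gen // !inE eqxx.
have Lt : t \in L by rewrite -Lxt mem_gen // !inE eqxx orbT.
have nZx := subsetP nZL x Lx; have nZt := subsetP nZL t Lt.
apply/eqP/idPn=> nv1.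
pose C := 'C_(Q / 'Z(Q))(<[coset 'Z(Q) x]>)%G.
have Cv : v \in C by rewrite /= cent_cycle fixed_conjE Vv vx eqxx.
have nCL : L / 'Z(Q) \subset 'N(C).
  rewrite normsI ?quotient_norms // norms_cent //.
  rewrite (norm_gens defG Lxt) (subsetP (normG _)) ?cycle_id //=.
  by rewrite inE -cycleJ -morphJ // xt morphV // cycleV.
pose P := (coset 'Z(Q) @*^-1 C)%G.
have sPQ : P \subset Q by rewrite -(quotientGK (center_normal Q)) morphpreS ?subsetIl.
have sZP : 'Z(Q) \subset P by apply: sub_cosetpre.
have nPG : G \subset 'N(P).
  rewrite (normal_between defG) // (subset_trans _ (morphpre_norms _ nCL)) //.
  by rewrite -sub_quotient_pre.
have pZP : 'Z(Q) \proper P.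
  rewrite properE sZP -quotient_sub1 ?(subset_trans sPQ) ?normal_norm ?center_normal //.
  by rewrite cosetpreK; apply: contra nv1 => /subsetP/(_ v Cv); rewrite inE.
(* A chief factor inside C_V(x) would be a natural module on which x is trivial. *)
have [H /mingroupP[/andP[pZH nHG] minH] sHP] :=
  mingroup_exists (gP := fun H : {group gT} => ('Z(Q) \proper H) && (G \subset 'N(H)))
    (introT andP (conj pZP nPG)).
have sHQ := subset_trans sHP sPQ.
have chH : chief_factor G 'Z(Q) H.
  rewrite /chief_factor /normal nHG (subset_trans sHQ) // !andbT.
  apply/maxgroupP; split; first by rewrite pZH.
  move=> K /andP[pKH nKG] sZK; apply/eqP; rewrite eq_sym eqEproper sZK /=.
  apply/negP=> pZK; have := minH K; rewrite pZK nKG (proper_sub pKH) => /(_ isT isT) eqK.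
  by rewrite eqK properxx in pKH.
have [psi [phi [[kerp _] [kphi imphi] phiJ]]] := natF 'Z(Q)%G H (subxx _) sHQ chH.
(* Each basis vector is [phi b] for some [b] in [H], and [b^x] lies in the coset of [b] modulo the
   kernel of [phi], so [psi x] fixes every basis vector. *)
have psix : psi x = 1.
  apply: val_inj; apply/row_matrixP=> i; rewrite !rowE mulmx1.
  have : delta_mx 0%R i \in phi @* H by rewrite imphi inE.
  case/morphimP=> b _ Hb ->; rewrite -[LHS](phiJ b x Hb (subsetP sLG x Lx)).
  have Hbx : b ^ x \in H by rewrite memJ_norm // (subsetP nHG) ?(subsetP sLG).
  have nZH := subset_trans sHQ (normal_norm (center_normal Q)).
  suffices kb : b^-1 * b ^ x \in 'ker phi.
    have := morphM phi Hb (groupM (groupVr Hb) Hbx).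
    by rewrite mulKVg (mker kb) mulg1.
  have nZb := subsetP nZH b Hb; have nZbx := subsetP nZH _ Hbx.
  rewrite kphi coset_idr ?groupM ?groupV // morphM ?groupV // morphV // morphJ //.
  have : coset 'Z(Q) b \in C by rewrite -(cosetpreK C) mem_quotient // (subsetP sHP).
  by rewrite /= cent_cycle fixed_conjE => /andP[_ /eqP->]; rewrite mulVg.
have : x \in Q :&: L by rewrite inE Lx -kerp !inE psix eqxx (subsetP sLG).
by rewrite tiQL inE (negPf nx1).
Qed.

(** * Transfer of the axioms and of the dents to [Gi] *)

Theorem lemma5p1 (gT : finGroupType) (m : nat) (G Q L : {group gT})
    (k : nat) (U : 'I_k -> {set option {group gT}}) (n : 'I_k -> nat) :
  biextraspecial m G Q ->
  Q ><| L = G ->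
  (forall i, dent_subspace G Q L (U i)) ->
  (forall i, U i != [set None]) ->
  (forall i, nondegenerate_dents (U i)) ->
  (forall i, has_dim Q L (U i) (n i)) ->
  orthogonal_sum G Q L U ->
  forall i : 'I_k,
    let Qi := dents_gen (U i) in
    let Gi := (Qi <*> L)%G in
    [/\ Qi ><| L = Gi,
        biextraspecial (n i) Gi Qi
      & dent_space Gi Qi L = U i].
Proof.
move=> bieG defG subU ntU ndU dimU _ i Qi Gi.
have [_ [nQG pQ oQ isoGQ] natZ [abelV oV natF]] := bieG.
have [x [t [Lxt nx1 x3 t2 xt]]] := natural_section_gens defG natZ.
have fpf := biextraspecial_fpf bieG defG Lxt nx1 xt.
have cVV := abelem_abelian abelV.
have sZQi : 'Z(Q) \subset Qi := center_sub_dents_gen defG cVV (subU i) (ntU i).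
have sQiQ : Qi \subset Q := dents_gen_subQ defG cVV Lxt x3 t2 xt abelV fpf (subU i) (ntU i).
have nQiG : G \subset 'N(Qi) := dents_gen_norm defG cVV Lxt x3 t2 xt abelV fpf (subU i) (ntU i).
have cQi : 'Z(Qi) = 'Z(Q) :=
  center_dents_gen defG cVV Lxt x3 t2 xt abelV fpf (subU i) (ntU i) (ndU i).
have oQi := card_dents_gen defG cVV Lxt x3 t2 xt abelV fpf (subU i) (ntU i).
have oU := card_has_dim (subU i) (dimU i).
have [sLG nQL tiQL] : [/\ L \subset G, L \subset 'N(Q) & Q :&: L = 1].
  by have [_ sLG _ nQL tiQL] := sdprod_context defG.
have defGi : Qi ><| L = Gi.
  by apply: sdprodEY; [apply: subset_trans nQiG | apply/trivgP; rewrite -tiQL setSI].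
have sGiG : Gi \subset G by rewrite join_subG sLG (subset_trans sQiQ (normal_sub nQG)).
have [_ defQL _ _] := sdprodP defG.
have defQGi : Q * Gi = G.
  apply/eqP; rewrite eqEsubset mul_subG ?(normal_sub nQG) //= -{1}defQL mulgS //.
  exact: joing_subr.
have QiE : (Gi :&: Q)%G = Qi.
  apply/group_inj => /=; case/sdprodP: defGi => _ <- _ _.
  by rewrite -group_modl // [L :&: Q]setIC tiQL mulg1.
have natGi (A B : {group gT}) : natural_section G Q A B -> natural_section Gi Qi A B.
  by move/natural_section_sub => /(_ _ defQGi); rewrite QiE.
(* Normality in [Gi] and in [G] both amount to normalisation by [L]; chief factors and dents are
   transferred through this. *)
have normE (H : {group gT}) : 'Z(Q) \subset H -> H \subset Qi ->
    (Gi \subset 'N(H)) = (G \subset 'N(H)).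
  move=> sZH sHQi; apply/idP/idP; last exact: subset_trans.
  rewrite (normal_between defG) // ?(subset_trans sHQi) //.
  by apply: subset_trans; apply: joing_subr.
have abelVi : 2.-abelem (Qi / 'Z(Q)) by apply: abelemS abelV; apply: quotientS.
have nZQi : Qi \subset 'N('Z(Q)) := subset_trans sQiQ (normal_norm (center_normal Q)).
have oZ : #|'Z(Q)| = 4.
  have := Lagrange (center_sub Q).
  rewrite -card_quotient ?normal_norm ?center_normal // oV oQ expnD => /eqP.
  by rewrite eqn_pmul2r ?expn_gt0 // => /eqP.
have [D UD] := subspace_dent (subU i) (ntU i).
have oQi' : #|Qi| = (2 ^ (2 + 2 * n i))%N by rewrite oQi oZ oU expnD -expnM [(2 * _)%N]mulnC.
split=> //.
  split.
  (* Rank 0 would leave [U i] a single element, but it holds both the zero and [D]. *)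
  - rewrite lt0n; apply/eqP=> n0.
    have: #|[set None; Some D]| <= #|U i|.
      by apply: subset_leq_card; rewrite subUset !sub1set UD; case: (subU i) => _ ->.
    by rewrite cards2 oU n0.
  - split=> //.
    + by rewrite /normal joing_subl join_subG normG (subset_trans sLG).
    + exact: pgroupS sQiQ pQ.
    (* Both [Gi / Qi] and [G / Q] are isomorphic to [L]. *)
    rewrite SL2_2E in isoGQ *; apply: isog_trans (isog_trans (sdprod_isog defG) isoGQ).
    by rewrite isog_sym; apply: sdprod_isog.
  - have -> : ('Z(Qi) = 'Z(Q))%G by apply/group_inj.
    exact: natGi.
  split.
  - by rewrite cQi.
  - by rewrite cQi card_quotient // -divgS // oQi' oZ expnD mulKn.
  move=> A B; rewrite cQi => sZA sBQi /andP[/maxgroupP[/andP[pAB nAGi] maxA] /andP[sBGi nBGi]].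
  have sAQi := subset_trans (proper_sub pAB) sBQi.
  have sZB := subset_trans sZA (proper_sub pAB).
  have sBQ := subset_trans sBQi sQiQ.
  (* A chief factor of [Gi] here is one of [G]: a [G]-normal subgroup between [A] and [B] is also
     [Gi]-normal. *)
  apply/natGi/natF => //; apply/andP; split.
    apply/maxgroupP; split; first by rewrite pAB -normE.
    move=> K /andP[pKB nKG] sAK; apply: maxA => //.
    by rewrite pKB (subset_trans sGiG).
  by rewrite /normal (subset_trans sBQ (normal_sub nQG)) -normE.
apply/setP=> [[E|]]; rewrite inE; last by case: (subU i).
have cVVi : abelian (Qi / 'Z(Qi)) by rewrite cQi (abelem_abelian abelVi).
apply/idP/idP => [/(dentP defGi cVVi) | UE].
  rewrite cQi => -[pZE sEQi nEGi minE].
  apply: (mem_subspace_dent defG cVV Lxt x3 t2 xt abelV fpf (subU i)) => //.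
  have sZE := proper_sub pZE.
  apply/(dentP defG cVV); split=> //; first exact: subset_trans sQiQ.
    by rewrite -normE.
  by move=> K pZK sKE nKG; apply: minE => //; apply: subset_trans nKG.
have sEQi : E \subset Qi := dent_sub_dents_gen UE.
have : dent G Q L E by case: (subU i) => /subsetP/(_ _ UE); rewrite inE.
case/(dentP defG cVV) => pZE sEQ nEG minE.
apply/(dentP defGi cVVi); rewrite cQi; split=> //; first exact: subset_trans nEG.
move=> K pZK sKE nKGi; apply: minE => //.
by rewrite -normE ?(subset_trans sKE) // proper_sub.
Qed.
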